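(* (Primal) If the primal problem has a feasible solution $\bar{x}\in\mathbb{R}^J$ and a primal ray $\hat{x}\in\mathbb{R}^J$, then the primal problem is unbounded (its optimal value is $-\infty$). (Dual) If the dual problem has a feasible solution $(\bar{y},\bar{w})\in \mathbb{R}^{M}\times \mathbb{R}^{I\times J}$ and a dual ray $(\hat{y},\hat{w})\in \mathbb{R}^{M}\times \mathbb{R}^{I\times J}$ such that $$\nabla F^i\left(\bar{w}^i\right)^T \hat{y}^i=\nabla F^i\left(\hat{w}^i\right)^T \hat{y}^i \quad \forall i \in I,$$ then the dual problem is unbounded (its optimal value is $+\infty$).
   Context: Setting. $I$ and $J$ are finite sets, $c\in\mathbb{R}^J$, and for each $i\in I$, $M_i$ is a finite set, $F^i:\mathbb{R}^J\to\mathbb{R}^{M_i}$ and $g_i:\mathbb{R}^{M_i}\to\mathbb{R}\cup\{+\infty\}$. Write $\mathbb{R}^M:=\prod_{i\in I}\mathbb{R}^{M_i}$, so $y\in\mathbb{R}^M$ has blocks $y^i\in\mathbb{R}^{M_i}$, and $w\in\mathbb{R}^{I\times J}$ has blocks $w^i\in\mathbb{R}^J$. $(g_i\circ F^i)(x):=g_i(F^i(x))$. Standing assumptions, for each $i\in I$: (i) there is $\bar{x}^i\in\mathbb{R}^J$ with $g_i(F^i(\bar{x}^i))<+\infty$; (ii) $F^i$ is continuously differentiable; (iii) $g_i$ is a proper, closed (lower semicontinuous) and convex function; (iv) $(x,u)\mapsto g_i(F^i(x)+u)$ is jointly convex in $(x,u)\in\mathbb{R}^J\times\mathbb{R}^{M_i}$.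 Notation. $\nabla F^i(x)\in\mathbb{R}^{M_i\times J}$ is the Jacobian of $F^i$ at $x$; $g_i^*(v):=\sup_{z\in\mathbb{R}^{M_i}}\{v\cdot z-g_i(z)\}$ is the convex conjugate; $F^i_\nabla(y^i,w^i):=(\nabla F^i(w^i)w^i-F^i(w^i))\cdot y^i$. For a proper closed convex $h:\mathbb{R}^L\to\mathbb{R}\cup\{+\infty\}$, its asymptotic (horizon) function is $h_\infty(d):=\sup_{t>0}\frac{h(\bar{z}+td)-h(\bar{z})}{t}$, where $\bar{z}$ is an arbitrary point with $h(\bar{z})<+\infty$. Primal problem: $\inf_{x\in\mathbb{R}^J} c\cdot x+\sum_{i\in I}g_i(F^i(x))$. Dual problem: $\sup_{y\in\mathbb{R}^M,\,w\in\mathbb{R}^{I\times J}}\; -\sum_{i\in I}\left(F^i_\nabla(-y^i,w^i)+g_i^*(-y^i)\right)$ subject to $\sum_{i\in I}\nabla F^i(w^i)^Ty^i=c$. Feasibility. $\bar{x}\in\mathbb{R}^J$ is primal feasible if $g_i(F^i(\bar{x}))<+\infty$ for all $i\in I$. $(\bar{y},\bar{w})$ is dual feasible if $g_i^*(-\bar{y}^i)<+\infty$ for all $i\in I$ and $\sum_{i\in I}\nabla F^i(\bar{w}^i)^T\bar{y}^i=c$. Rays. A primal ray is $\hat{x}\in\mathbb{R}^J$ with $c\cdot\hat{x}+\sum_{i\in I}(g_i\circ F^i)_\infty(\hat{x})<0$. A dual ray is $(\hat{y},\hat{w})\in\mathbb{R}^M\times\mathbb{R}^{I\times J}$ with $\sum_{i\in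 I}\nabla F^i(\hat{w}^i)^T\hat{y}^i=0$ and $-\sum_{i\in I}\left(F^i_\nabla(-\hat{y}^i,\hat{w}^i)+(g_i^* )_\infty(-\hat{y}^i)\right)>0$. *)

(* Defs.v *)
From HB Require Import structures.
From mathcomp Require Import all_boot all_order all_algebra.
From mathcomp Require Import all_classical all_reals all_analysis.

Set Implicit Arguments.
Unset Strict Implicit.
Unset Printing Implicit Defensive.

Import Order.TTheory GRing.Theory Num.Theory.
Import numFieldNormedType.Exports.

Local Open Scope classical_set_scope.
Local Open Scope ring_scope.

Definition dot (R : realType) (k : nat) (u v : 'rV[R]_k) : R :=
  (u *m v^T) 0 0.

(* The products 0 * +oo arising at t = 0 and t = 1 are 0 in \bar R, so the
   inequality is trivial there. *)
Definition econvex (R : realType) (V : lmodType R) (h : V -> \bar R) : Prop :=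
  forall (x y : V) (t : R), 0 <= t <= 1 ->
    (h (t *: x + (1 - t) *: y)%R <= t%:E * h x + (1 - t)%:E * h y)%E.

(* Functions into R U {+oo} are \bar R-valued functions avoiding -oo. *)
Definition proper_fun (R : realType) (V : Type) (h : V -> \bar R) : Prop :=
  (forall z, h z != -oo%E) /\ exists z, (h z < +oo)%E.

Definition closed_proper_convex (R : realType) (k : nat)
    (h : 'rV[R]_k -> \bar R) : Prop :=
  [/\ proper_fun h, lower_semicontinuous h & econvex h].

Definition conjugate (R : realType) (k : nat) (h : 'rV[R]_k -> \bar R)
    (v : 'rV[R]_k) : \bar R :=
  ereal_sup [set ((dot v z)%:E - h z)%E | z in [set: 'rV[R]_k]].

(* The base point is a chosen element of the effective domain of h; for proper
   closed convex h the value does not depend on it. *)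
Definition horizon (R : realType) (k : nat) (h : 'rV[R]_k -> \bar R)
    (d : 'rV[R]_k) : \bar R :=
  let zbar := xget 0 [set z | (h z < +oo)%E] in
  ereal_sup [set ((h (zbar + t *: d)%R - h zbar) * (t^-1)%:E)%E
            | t in [set t : R | 0 < t]].

Definition C1 (R : realType) (n m : nat) (f : 'rV[R]_n -> 'rV[R]_m) : Prop :=
  (forall x, differentiable f x) /\ continuous (fun x => 'J f x).

(* Vectors are rows and 'J f w satisfies 'd f w v = v *m 'J f w, so it is the
   transpose of the usual Jacobian matrix: the column vectors (nabla f(w)) v
   and (nabla f(w))^T y are the rows v *m 'J f w and y *m ('J f w)^T. *)
Definition jac_tr_mul (R : realType) (n m : nat) (f : 'rV[R]_n -> 'rV[R]_m)
    (w : 'rV[R]_n) (y : 'rV[R]_m) : 'rV[R]_n :=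
  y *m ('J f w)^T.

Definition F_nabla (R : realType) (n m : nat) (f : 'rV[R]_n -> 'rV[R]_m)
    (y : 'rV[R]_m) (w : 'rV[R]_n) : R :=
  dot (w *m 'J f w - f w) y.

Section Problems.
Context (R : realType) (I : finType) (n : nat) (m : I -> nat).
Context (c : 'rV[R]_n) (F : forall i, 'rV[R]_n -> 'rV[R]_(m i))
  (g : forall i, 'rV[R]_(m i) -> \bar R).

Definition standing_assumptions : Prop :=
  forall i : I,
    [/\ exists xbar, (g (F i xbar) < +oo)%E,
        C1 (F i),
        closed_proper_convex (@g i) &
        econvex (fun p : 'rV[R]_n * 'rV[R]_(m i) => g (F i p.1 + p.2))].

Definition primal_objective (x : 'rV[R]_n) : \bar R :=
  ((dot c x)%:E + \sum_(i : I) g (F i x))%E.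

Definition primal_value : \bar R :=
  ereal_inf [set primal_objective x | x in [set: 'rV[R]_n]].

Definition primal_feasible (x : 'rV[R]_n) : Prop :=
  forall i, (g (F i x) < +oo)%E.

Definition primal_ray (x : 'rV[R]_n) : Prop :=
  ((dot c x)%:E + \sum_(i : I) horizon (fun z => g (F i z)) x < 0)%E.

Implicit Types (y : forall i, 'rV[R]_(m i)) (w : I -> 'rV[R]_n).

Definition dual_objective y w : \bar R :=
  (- \sum_(i : I)
      ((F_nabla (F i) (- y i)%R (w i))%:E + conjugate (@g i) (- y i)%R))%E.

Definition dual_constraint y w : Prop :=
  \sum_(i : I) jac_tr_mul (F i) (w i) (y i) = c.

Definition dual_value : \bar R :=
  ereal_sup [set v | exists y w, dual_constraint y w /\ v = dual_objective y w].

Definition dual_feasible y w : Prop :=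
  (forall i, (conjugate (@g i) (- y i)%R < +oo)%E) /\ dual_constraint y w.

Definition dual_ray y w : Prop :=
  \sum_(i : I) jac_tr_mul (F i) (w i) (y i) = 0 /\
  (0 < - \sum_(i : I)
      ((F_nabla (F i) (- y i)%R (w i))%:E
       + horizon (conjugate (@g i)) (- y i)%R))%E.

End Problems.

(* Main.v *)
Require Import Defs.
From mathcomp Require Import all_boot all_order all_algebra.
From mathcomp Require Import all_classical all_reals all_analysis.
From mathcomp Require Import ring lra.

Set Implicit Arguments.
Unset Strict Implicit.
Unset Printing Implicit Defensive.

Import Order.TTheory GRing.Theory Num.Theory.
Import numFieldNormedType.Exports.

Local Open Scope classical_set_scope.
Local Open Scope ring_scope.

(** Both halves follow the same line: along the ray the objective is bounded by
an affine function of the step t whose slope has the good sign.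

For the primal problem each [g_i o F^i] is proper, closed and convex (closed
because [F^i] is continuous, convex by joint convexity at [u = 0]), and such a
function grows at most at the rate of its horizon value from every point of
its domain, not only from the base point that defines the horizon function:
this is [closed_convex_growth]. Hence the objective at [xbar + t xhat] is at
most its value at [xbar] plus [t] times the negative number attached to the
ray.

For the dual problem the multipliers move along [ybar + t yhat] while [w] stays
at [wbar]; the compatibility hypothesis on the Jacobians is what keeps the
constraint satisfied. Conjugates grow at the rate of their horizon value for an
elementary reason: a finite horizon value of [g_i^*] at [v] bounds the linear
form [v] on the domain of [g_i] ([conjugate_horizon_support]), and this bound
gives the growth estimate ([conjugate_growth]). The ray, however, evaluates
[F_nabla] at [what] whereas the moving point evaluates it at [wbar]. These
agree. With [v = - yhat_i], joint convexity makes the convexity defect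
[D = F(l x + (1 - l) y) - l F(x) - (1 - l) F(y)] a direction in which [g_i]
does not increase, so the domain of [g_i] contains all [z + N D]; boundedness
of [v] there forces [v . D <= 0], that is, [v . F] is convex
([support_convex]). Now [F_nabla v w] is minus the value at the origin of the
tangent to [v . F] at [w], and a convex function with equal gradients at two
points has the same tangent at both ([F_nabla_eq_gradient]). *)

(** * Inner products *)

Lemma dotE (R : realType) k (u v : 'rV[R]_k) :
  dot u v = \sum_j u 0 j * v 0 j.
Proof. by rewrite /dot mxE; apply: eq_bigr => j _; rewrite mxE. Qed.

Lemma dotC (R : realType) k (u v : 'rV[R]_k) : dot u v = dot v u.
Proof. by rewrite !dotE; apply: eq_bigr => j _; rewrite mulrC. Qed.

Lemma dotDl (R : realType) k (u v w : 'rV[R]_k) :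
  dot (u + v) w = dot u w + dot v w.
Proof. by rewrite /dot mulmxDl mxE. Qed.

Lemma dotZl (R : realType) k t (u w : 'rV[R]_k) :
  dot (t *: u) w = t * dot u w.
Proof. by rewrite /dot -scalemxAl mxE. Qed.

Lemma dotNl (R : realType) k (u w : 'rV[R]_k) : dot (- u) w = - dot u w.
Proof. by rewrite /dot mulNmx mxE. Qed.

Lemma dotBl (R : realType) k (u v w : 'rV[R]_k) :
  dot (u - v) w = dot u w - dot v w.
Proof. by rewrite dotDl dotNl. Qed.

Lemma dotDr (R : realType) k (u v w : 'rV[R]_k) :
  dot w (u + v) = dot w u + dot w v.
Proof. by rewrite !(dotC w) dotDl. Qed.

Lemma dotZr (R : realType) k t (u w : 'rV[R]_k) :
  dot w (t *: u) = t * dot w u.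
Proof. by rewrite !(dotC w) dotZl. Qed.

Lemma dot_continuousl (R : realType) k (v : 'rV[R]_k) :
  continuous (fun u : 'rV[R]_k => dot u v).
Proof.
rewrite (_ : (fun u => _) = fun u : 'rV[R]_k => \sum_j u 0 j * v 0 j); last first.
  by apply/funext => u; rewrite dotE.
apply: continuous_big => [|j _ u]; first exact: add_continuous.
exact: (cvgM (@coord_continuous R 1 k 0 j u) (cvg_cst (v 0 j))).
Qed.

(** * Elementary facts on extended reals *)

Lemma affine_unbounded_below (R : realType) (a b : R) :
  b < 0 -> forall A, exists2 t, 0 < t & a + t * b <= A.
Proof.
move=> b0 A; exists (`|a - A| / - b + 1).
  by rewrite ltr_wpDl// divr_ge0// oppr_ge0 ltW.
have -> : (`|a - A| / - b + 1) * b = - `|a - A| + b by field; rewrite ?oppr_eq0; lra.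
have := ler_norm (a - A); lra.
Qed.

Lemma sum_lty_fin_num (R : realType) (I : finType) (u : I -> \bar R) :
  (forall i, u i != -oo%E) -> (\sum_i u i < +oo)%E ->
  forall i, u i \is a fin_num.
Proof.
move=> uNy ult i; rewrite fin_numE uNy/=; apply/negP => uiy.
have : (\sum_i u i)%E == +oo%E.
  by rewrite esum_eqy//; apply/existsP; exists i.
by apply/negP; rewrite lt_eqF.
Qed.

(** * Growth along a direction of finite horizon value *)

(** The base point chosen inside [horizon] is only known to lie in the domain;
this hides the choice, and the extended-real quotient with it. *)
Lemma horizon_growth (R : realType) k (h : 'rV[R]_k -> \bar R) d :
  proper_fun h ->
  exists z a, h z = a%:E /\
    forall s : R, 0 < s -> (h (z + s *: d)%R <= a%:E + horizon h d * s%:E)%E.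
Proof.
move=> [hNy hfin]; rewrite /horizon; set z := xget _ _; set S := [set _ | _ in _].
have hz : (h z < +oo)%E := xgetPex 0 hfin.
have hzfin : h z \is a fin_num by rewrite fin_numE hNy lt_eqF.
exists z, (fine (h z)); rewrite fineK//; split=> // s s0.
rewrite -leeBlDl// -lee_pdivrMr//.
by apply: ereal_sup_ubound; exists s.
Qed.

(** Since no summand is -oo, a ray inequality on a sum of horizon values makes each
of them a real number. *)
Lemma horizon_neqNy (R : realType) k (h : 'rV[R]_k -> \bar R) d :
  proper_fun h -> horizon h d != -oo%E.
Proof.
move=> hp; have [z [a [_ /(_ 1 ltr01) hgr]]] := horizon_growth d hp.
apply/eqP => hy; move: hgr; rewrite hy mule1 addeNy leeNy_eq.
by rewrite (negbTE (hp.1 _)).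
Qed.

(** With [z] the base point of the horizon, the points [z + s d], for large [s], are
seen from [x] almost in the direction [d]. Convexity bounds [h] on the segment
from [x] to [z + s d], and lower semicontinuity passes to the limit [s -> oo]. *)
Lemma closed_convex_growth (R : realType) k (h : 'rV[R]_k -> \bar R) d
    (r : R) :
  closed_proper_convex h -> horizon h d = r%:E ->
  forall x (t : R), (h x < +oo)%E -> 0 < t ->
  (h (x + t *: d)%R <= h x + (t * r)%:E)%E.
Proof.
move=> [hp hlsc hcvx] hr x t hx t0.
have [z [b [hz hgr]]] := horizon_growth d hp; rewrite hr in hgr.
have xfin : h x \is a fin_num by rewrite fin_numE hp.1 lt_eqF.
move: hx; rewrite -(fineK xfin); set a := fine (h x) => _.
(* With [l = t / s], [p l] is the point of the segment from [x] to [z + s d] at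
   parameter [l]; it tends to [x + t d] as [l -> 0+]. *)
pose p l := (x + t *: d) + l *: (z - x).
have hpl l : 0 < l -> l < 1 -> (h (p l) <= (a + t * r + l * (b - a))%:E)%E.
  move=> l0 l1; have tl0 : 0 < t / l by rewrite divr_gt0.
  have -> : p l = l *: (z + (t / l) *: d) + (1 - l) *: x.
    by rewrite /p; apply/rowP => j; rewrite !mxE; field; rewrite gt_eqF.
  apply: le_trans (hcvx _ _ l _) _; first by rewrite !ltW.
  rewrite -(fineK xfin) -/a.
  have -> : a + t * r + l * (b - a) = l * (b + r * (t / l)) + (1 - l) * a.
    by field; rewrite gt_eqF.
  rewrite [X in (_ <= X)%E]EFinD; apply: leeD; last by rewrite EFinM.
  by rewrite EFinM lee_pmul2l ?lte_fin// EFinD EFinM hgr.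
apply/lee_addgt0Pr => e e0; rewrite leNgt -!EFinD; apply/negP => lth.
have [V Vnb hV] := hlsc _ _ lth.
have pcvg : p l @[l --> (0:R)^'+] --> x + t *: d.
  apply: cvg_at_right_filter; rewrite -[X in _ --> X]addr0.
  apply: cvgD; first exact: cvg_cst.
  rewrite -(scale0r (z - x)); apply: cvgZr_tmp; exact: cvg_id.
have lcvg : l * (b - a) @[l --> (0:R)^'+] --> (0 : R).
  apply: cvg_at_right_filter; rewrite -[X in _ --> X](mul0r (b - a)).
  by apply: cvgM; [exact: cvg_id|exact: cvg_cst].
have : \forall l \near (0:R)^'+, False; last by move/filter_ex => [].
near=> l.
have l0 : 0 < l by near: l; exact: nbhs_right_gt.
have l1 : l < 1 by near: l; exact: nbhs_right_lt.
have lV : V (p l) by near: l; exact: pcvg.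
have le : l * (b - a) <= e by near: l; exact: (cvgr_le 0 lcvg).
have := lt_le_trans (hV _ lV) (hpl l l0 l1).
by rewrite lte_fin; lra.
Unshelve. all: by end_near. Qed.

(** * Conjugate functions *)

Lemma conjugate_neqNy (R : realType) k (h : 'rV[R]_k -> \bar R) v :
  proper_fun h -> conjugate h v != -oo%E.
Proof.
move=> [hNy [z hz]].
have hzfin : h z \is a fin_num by rewrite fin_numE hNy lt_eqF.
rewrite gt_eqF//; apply: (@lt_le_trans _ _ ((dot v z)%:E - h z)%E).
  by rewrite -(fineK hzfin) -EFinB ltNyr.
by apply: ereal_sup_ubound; exists z.
Qed.

(** One half of the identity between the horizon function of [h^*] and the support
function of the domain of [h]: the affine minorants [u |-> u . z - h z] of
[h^*] cannot grow faster than [h^*] itself. *)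
Lemma conjugate_horizon_support (R : realType) k (h : 'rV[R]_k -> \bar R) v r :
  proper_fun h -> (exists u, (conjugate h u < +oo)%E) ->
  horizon (conjugate h) v = r%:E ->
  forall z, (h z < +oo)%E -> dot v z <= r.
Proof.
move=> hp cfin hr z hz.
have cp : proper_fun (conjugate h) by split=> // u; exact: conjugate_neqNy.
have [u [b [_ hgr]]] := horizon_growth v cp; rewrite hr in hgr.
have hzfin : h z \is a fin_num by rewrite fin_numE hp.1 lt_eqF.
have key s : 0 < s -> dot u z + s * dot v z - fine (h z) <= b + s * r.
  move=> s0; rewrite -lee_fin.
  have -> : (b + s * r)%:E = (b%:E + r%:E * s%:E)%E by rewrite EFinD EFinM muleC.
  apply: le_trans (hgr s s0); apply: ereal_sup_ubound; exists z => //.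
  by rewrite dotDl dotZl EFinB fineK.
rewrite leNgt; apply/negP => lt_r.
have rv : r - dot v z < 0 by lra.
have [s s0] := affine_unbounded_below b rv (dot u z - fine (h z) - 1).
by have := key s s0; lra.
Qed.

Lemma conjugate_growth (R : realType) k (h : 'rV[R]_k -> \bar R) u v r t :
  proper_fun h -> 0 <= t -> (forall z, (h z < +oo)%E -> dot v z <= r) ->
  (conjugate h (u + t *: v)%R <= conjugate h u + (t * r)%:E)%E.
Proof.
move=> hp t0 vr; apply: ge_ereal_sup => _ [z _ <-].
have [hz|] := boolP (h z < +oo)%E; last first.
  by rewrite ltey negbK => /eqP ->; rewrite addeNy leNye.
rewrite dotDl dotZl EFinD -addeA [((t * _)%:E + _)%E]addeC addeA.
apply: leeD; first by apply: ereal_sup_ubound; exists z.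
by rewrite lee_fin ler_wpM2l// vr.
Qed.

(** * Convexity of v . F *)

(** Joint convexity compares the points [(x, z - f x)] and [(y, z - f y)], at both
of which the composite takes the value [h z]. *)
Lemma joint_convexity_descent (R : realType) n m (f : 'rV[R]_n -> 'rV[R]_m)
    (h : 'rV[R]_m -> \bar R) (x y : 'rV[R]_n) (l : R) (z : 'rV[R]_m) :
  proper_fun h ->
  econvex (fun p : 'rV[R]_n * 'rV[R]_m => h (f p.1 + p.2)) ->
  0 <= l <= 1 ->
  (h (z + (f (l *: x + (1 - l) *: y) - (l *: f x + (1 - l) *: f y)))%R <= h z)%E.
Proof.
move=> hp hcvx l01.
have := hcvx (x, z - f x) (y, z - f y) l l01; rewrite /= !subrKC.
have -> : f (l *: x + (1 - l) *: y) + (l *: (z - f x) + (1 - l) *: (z - f y))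
    = z + (f (l *: x + (1 - l) *: y) - (l *: f x + (1 - l) *: f y)).
  apply/rowP => j; rewrite !mxE; ring.
move/le_trans; apply; have [/eqP hy|hy] := boolP (h z == +oo%E).
  by rewrite hy leey.
have hzfin : h z \is a fin_num by rewrite fin_numE hp.1.
by rewrite -(fineK hzfin) -!EFinM -EFinD lee_fin; lra.
Qed.

(** The descent step can be repeated from [z], then from [z + D], and so on: the
domain of [h] contains all [z + N D], where [D] is the convexity defect, and a
linear form bounded above on these points is nonpositive at [D]. *)
Lemma support_convex (R : realType) n m (f : 'rV[R]_n -> 'rV[R]_m)
    (h : 'rV[R]_m -> \bar R) (v : 'rV[R]_m) (r : R) :
  proper_fun h ->
  econvex (fun p : 'rV[R]_n * 'rV[R]_m => h (f p.1 + p.2)) ->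
  (forall z, (h z < +oo)%E -> dot v z <= r) ->
  forall (x y : 'rV[R]_n) (l : R), 0 <= l <= 1 ->
  dot v (f (l *: x + (1 - l) *: y)) <= l * dot v (f x) + (1 - l) * dot v (f y).
Proof.
move=> hp hcvx vr x y l l01.
set D := f (l *: x + (1 - l) *: y) - (l *: f x + (1 - l) *: f y).
have [_ [z hz]] := hp.
have iterD N : (h (z + D *+ N)%R < +oo)%E.
  elim: N => [|N IH]; first by rewrite addr0.
  rewrite mulrSr addrA.
  exact: (le_lt_trans (joint_convexity_descent x y (z + D *+ N) hp hcvx l01) IH).
have -> : f (l *: x + (1 - l) *: y) = D + (l *: f x + (1 - l) *: f y).
  by rewrite subrK.
rewrite dotDr [dot v (l *: _ + _)]dotDr !dotZr gerDr leNgt; apply/negP => D0.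
have := vr _ (iterD (Num.bound ((r - dot v z) / dot v D))).
rewrite -scaler_nat dotDr dotZr; apply/negP; rewrite -ltNge.
by rewrite -ltrBlDl -ltr_pdivrMr// archi_boundP// divr_ge0 ?subr_ge0 ?vr// ltW.
Qed.

(** The slope of [v . f] from [x] towards [y] is at most the chord slope, by
convexity; let the step tend to 0 from the right. *)
Lemma gradient_inequality (R : realType) n m (f : 'rV[R]_n -> 'rV[R]_m)
    (v : 'rV[R]_m) (x y : 'rV[R]_n) :
  differentiable f x ->
  (forall l : R, 0 <= l <= 1 ->
  dot v (f (l *: y + (1 - l) *: x)) <= l * dot v (f y) + (1 - l) * dot v (f x)) ->
  dot (y - x) (jac_tr_mul f x v) <= dot v (f y) - dot v (f x).
Proof.
move=> fx fcvx.
have -> : dot (y - x) (jac_tr_mul f x v) = dot ('d f x (y - x)) v.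
  by rewrite /dot /jac_tr_mul trmx_mul trmxK mulmxA mul_rV_lin1.
have qcvg : dot (l^-1 *: (f (l *: (y - x) + x) - f x)) v @[l --> (0:R)^'+]
    --> dot ('d f x (y - x)) v.
  apply: (@cvg_comp _ _ _ (fun l => l^-1 *: (f (l *: (y - x) + x) - f x))
    (fun u => dot u v) _ (nbhs ('d f x (y - x)))); last exact: dot_continuousl.
  rewrite -deriveE//; apply: cvg_dnbhs_at_right; exact: diff_derivable.
apply: (cvgr_to_le qcvg); near=> l.
have l0 : 0 < l by near: l; exact: nbhs_right_gt.
have l1 : l < 1 by near: l; exact: nbhs_right_lt.
rewrite dotZl mulrC ler_pdivrMr// dotBl.
have -> : l *: (y - x) + x = l *: y + (1 - l) *: x.
  by apply/rowP => j; rewrite !mxE; ring.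
have : 0 <= l <= 1 by rewrite !ltW.
by move/fcvx; rewrite !(dotC v); lra.
Unshelve. all: by end_near. Qed.

(** In this form [F_nabla f v w] is minus the value at the origin of the tangent to
[v . f] at [w]. *)
Lemma F_nablaE (R : realType) n m (f : 'rV[R]_n -> 'rV[R]_m)
    (v : 'rV[R]_m) (w : 'rV[R]_n) :
  F_nabla f v w = dot w (jac_tr_mul f w v) - dot v (f w).
Proof.
rewrite /F_nabla dotBl [dot v _]dotC; congr (_ - _).
by rewrite /dot /jac_tr_mul trmx_mul trmxK mulmxA.
Qed.

(** The gradient inequalities at [w] and at [w'] involve the same gradient and so are
opposite to each other: both are equalities. *)
Lemma F_nabla_eq_gradient (R : realType) n m (f : 'rV[R]_n -> 'rV[R]_m)
    (v : 'rV[R]_m) (w w' : 'rV[R]_n) :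
  (forall x, differentiable f x) ->
  (forall (x y : 'rV[R]_n) (l : R), 0 <= l <= 1 ->
  dot v (f (l *: x + (1 - l) *: y)) <= l * dot v (f x) + (1 - l) * dot v (f y)) ->
  jac_tr_mul f w v = jac_tr_mul f w' v ->
  F_nabla f v w = F_nabla f v w'.
Proof.
move=> fd fcvx eqg; rewrite !F_nablaE -eqg.
have := gradient_inequality (fd w) (fcvx w' w).
have := gradient_inequality (fd w') (fcvx w w').
by rewrite -eqg !dotBl => h1 h2; apply/eqP; rewrite eq_le; apply/andP; split; lra.
Qed.

(** * Unboundedness along rays *)

Lemma comp_closed_proper_convex (R : realType) n m (f : 'rV[R]_n -> 'rV[R]_m)
    (h : 'rV[R]_m -> \bar R) :
  (exists x, (h (f x) < +oo)%E) -> continuous f -> closed_proper_convex h ->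
  econvex (fun p : 'rV[R]_n * 'rV[R]_m => h (f p.1 + p.2)) ->
  closed_proper_convex (fun x => h (f x)).
Proof.
move=> fin fcont [hp hlsc _] hcvx; split.
- by split=> // x; exact: hp.1.
- move=> x a /hlsc[V Vnb hV]; exists (f @^-1` V); first exact: fcont.
  by move=> y; exact: hV.
- move=> x y t t01; have := hcvx (x, 0) (y, 0) t t01.
  by rewrite /= !scaler0 !addr0.
Qed.

Lemma primal_unbounded (R : realType) (I : finType) (n : nat) (m : I -> nat)
    (c : 'rV[R]_n) (F : forall i, 'rV[R]_n -> 'rV[R]_(m i))
    (g : forall i, 'rV[R]_(m i) -> \bar R) (xbar xhat : 'rV[R]_n) :
  standing_assumptions F g -> primal_feasible F g xbar ->
  primal_ray c F g xhat -> primal_value c F g = -oo%E.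
Proof.
move=> hyp feas ray.
have hcpc i : closed_proper_convex (fun x => g i (F i x)).
  have [fin [Fd _] gcpc gcvx] := hyp i.
  apply: comp_closed_proper_convex => // x.
  exact: differentiable_continuous.
have hfin i : g i (F i xbar) \is a fin_num.
  by have [[gNy _] _ _] := hcpc i; rewrite fin_numE gNy lt_eqF// feas.
pose H i := horizon (fun x => g i (F i x)) xhat.
have Hfin : forall i, H i \is a fin_num.
  apply: sum_lty_fin_num => [i|].
    by apply: horizon_neqNy; have [] := hcpc i.
  rewrite -(@lteD2lE _ (dot c xhat)%:E)//.
  by rewrite (lt_trans ray)// addey.
set A := dot c xbar + \sum_i fine (g i (F i xbar)).
set B := dot c xhat + \sum_i fine (H i).
have B0 : B < 0.
  move: ray; rewrite /primal_ray (eq_bigr (fun i => (fine (H i))%:E)).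
    by rewrite sumEFin -EFinD lte_fin.
  by move=> i _; rewrite fineK.
have growth t : 0 < t ->
    (primal_objective c F g (xbar + t *: xhat)%R <= (A + t * B)%:E)%E.
  move=> t0; have -> : A + t * B = dot c (xbar + t *: xhat) +
      \sum_i (fine (g i (F i xbar)) + t * fine (H i)).
    by rewrite big_split/= -mulr_sumr dotDr dotZr /A /B; ring.
  rewrite EFinD -sumEFin leeD2l//; apply: lee_sum => i _.
  rewrite EFinD fineK//; apply: (closed_convex_growth (hcpc i)) => //.
  by rewrite fineK.
suff le_all r : (primal_value c F g <= r%:E)%E.
  case: primal_value le_all => [s /(_ (s - 1)%R)|/(_ 0)|]//.
  by rewrite lee_fin lerDl oppr_ge0 ler10.
have [t t0 tr] := affine_unbounded_below A B0 r.
apply: le_trans (_ : (A + t * B)%:E <= _)%E; last by rewrite lee_fin.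
apply: le_trans (growth t t0).
by apply: ereal_inf_lbound; exists (xbar + t *: xhat).
Qed.

Lemma jac_tr_mulN (R : realType) n m (f : 'rV[R]_n -> 'rV[R]_m) w v :
  jac_tr_mul f w (- v) = - jac_tr_mul f w v.
Proof. exact: mulNmx. Qed.

Lemma jac_tr_mulDZ (R : realType) n m (f : 'rV[R]_n -> 'rV[R]_m) w u t v :
  jac_tr_mul f w (u + t *: v) = jac_tr_mul f w u + t *: jac_tr_mul f w v.
Proof. by rewrite /jac_tr_mul mulmxDl scalemxAl. Qed.

Lemma dual_unbounded (R : realType) (I : finType) (n : nat) (m : I -> nat)
    (c : 'rV[R]_n) (F : forall i, 'rV[R]_n -> 'rV[R]_(m i))
    (g : forall i, 'rV[R]_(m i) -> \bar R)
    (ybar : forall i : I, 'rV[R]_(m i)) (wbar : I -> 'rV[R]_n)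
    (yhat : forall i : I, 'rV[R]_(m i)) (what : I -> 'rV[R]_n) :
  standing_assumptions F g ->
  dual_feasible c F g ybar wbar -> dual_ray F g yhat what ->
  (forall i : I, jac_tr_mul (F i) (wbar i) (yhat i)
                 = jac_tr_mul (F i) (what i) (yhat i)) ->
  dual_value c F g = +oo%E.
Proof.
move=> hyp [feas cbar] [chat ray] eqg.
have gp i : proper_fun (@g i) by have [_ _ [] ] := hyp i.
have gsp i : exists u, (conjugate (@g i) u < +oo)%E by exists (- ybar i).
have cp i : proper_fun (conjugate (@g i)).
  by split=> // u; exact: conjugate_neqNy.
pose a i := fine (conjugate (@g i) (- ybar i)).
have aE i : conjugate (@g i) (- ybar i) = (a i)%:E.
  by rewrite fineK// fin_numE (cp i).1 lt_eqF.
pose H i := horizon (conjugate (@g i)) (- yhat i).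
pose k i := F_nabla (F i) (- yhat i) (what i).
have Hfin : forall i, H i \is a fin_num.
  move=> i; have : ((k i)%:E + H i)%E \is a fin_num.
    apply: (sum_lty_fin_num (u := fun i => ((k i)%:E + H i)%E)) => [j|].
      have : H j != -oo%E by exact: horizon_neqNy.
      by case: (H j).
    by move: ray; rewrite oppe_gt0 => /lt_trans; apply.
  by rewrite fin_numD => /andP[].
have HE i : H i = (fine (H i))%:E by rewrite fineK.
have support i z : (g i z < +oo)%E -> dot (- yhat i) z <= fine (H i).
  exact: (conjugate_horizon_support (gp i) (gsp i) (HE i)).
(* The slope along the ray is evaluated at [wbar], the ray inequality at [what]. *)
have kE i : F_nabla (F i) (- yhat i) (wbar i) = k i.
  have [_ [Fd _] _ gcvx] := hyp i.
  apply: (F_nabla_eq_gradient Fd (support_convex (gp i) gcvx (support i))).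
  by rewrite !jac_tr_mulN eqg.
set A := \sum_i (F_nabla (F i) (- ybar i) (wbar i) + a i).
set B := \sum_i (k i + fine (H i)).
have B0 : B < 0.
  rewrite -lte_fin /B -sumEFin; move: ray; rewrite oppe_gt0.
  by under eq_bigr => i _ do rewrite -/(H i) HE -EFinD.
(* [A] and [B] carry the sign of the sum inside the dual objective, hence the
   opposite signs in the bound. *)
have growth t : 0 < t ->
    ((- (A + t * B))%:E <=
     dual_objective F g (fun i => ybar i + t *: yhat i)%R wbar)%E.
  move=> t0; rewrite EFinN leeN2 mulr_sumr -big_split/= -sumEFin.
  apply: lee_sum => i _.
  have -> : - (ybar i + t *: yhat i) = - ybar i + t *: (- yhat i).
    by rewrite opprD scalerN.
  have -> : F_nabla (F i) (- ybar i + t *: - yhat i) (wbar i)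
      = F_nabla (F i) (- ybar i) (wbar i) + t * k i.
    by rewrite -kE /F_nabla dotDr dotZr.
  have := @conjugate_growth _ _ _ (- ybar i) (- yhat i) _ _
    (gp i) (ltW t0) (support i).
  rewrite aE => /(leeD2l (F_nabla (F i) (- ybar i) (wbar i) + t * k i)%:E).
  by move=> /le_trans; apply; rewrite -!EFinD lee_fin; lra.
have feas_ray t : dual_constraint c F (fun i => ybar i + t *: yhat i) wbar.
  rewrite /dual_constraint.
  under eq_bigr => i _ do rewrite jac_tr_mulDZ eqg.
  rewrite big_split/= -scaler_sumr [X in _ + _ *: X]chat scaler0 addr0.
  exact: cbar.
apply/eqyP => r _.
have [t t0 tr] := affine_unbounded_below A B0 (- r).
apply: le_trans (_ : (- (A + t * B))%:E <= _)%E; first by rewrite lee_fin; lra.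
apply: le_trans (growth t t0) _.
apply: ereal_sup_ubound.
by exists (fun i => ybar i + t *: yhat i), wbar; split.
Qed.

Theorem theorem3 (R : realType) (I : finType) (n : nat) (m : I -> nat)
    (c : 'rV[R]_n) (F : forall i : I, 'rV[R]_n -> 'rV[R]_(m i))
    (g : forall i : I, 'rV[R]_(m i) -> \bar R)
    (hyp : standing_assumptions F g) :
  (forall xbar xhat : 'rV[R]_n,
     primal_feasible F g xbar -> primal_ray c F g xhat ->
     primal_value c F g = -oo%E)
  /\
  (forall (ybar : forall i : I, 'rV[R]_(m i)) (wbar : I -> 'rV[R]_n)
          (yhat : forall i : I, 'rV[R]_(m i)) (what : I -> 'rV[R]_n),
     dual_feasible c F g ybar wbar -> dual_ray F g yhat what ->
     (forall i : I, jac_tr_mul (F i) (wbar i) (yhat i)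
                    = jac_tr_mul (F i) (what i) (yhat i)) ->
     dual_value c F g = +oo%E).
Proof.
split=> [xbar xhat|ybar wbar yhat what]; first exact: primal_unbounded.
exact: dual_unbounded.
Qed.
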